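(* Let $n\ge 4$. Any $(n+1)$-dimensional solvable non-Lie Leibniz algebra over $\mathbb{C}$ whose nilradical is isomorphic to $n_{n,1}$ is isomorphic to one of the following pairwise non-isomorphic algebras: $$R_{n+1,1}(0,0,1),\quad R_{n+1,1}(0,1,0),\quad R_{n+1,1}(1,1,0),\quad R_{n+1,1}(1,0,0).$$
   Context: All algebras are finite-dimensional over $\mathbb{C}$; in tables of multiplication, omitted products of basis elements are zero. A Leibniz algebra is a vector space $L$ with a bilinear bracket satisfying $[x,[y,z]]=[[x,y],z]-[[x,z],y]$ for all $x,y,z\in L$; it is non-Lie if it is not a Lie algebra. Set $L^1=L$, $L^{k+1}=[L^k,L]$ and $L^{[1]}=L$, $L^{[s+1]}=[L^{[s]},L^{[s]}]$; $L$ is nilpotent if some $L^k=0$ and solvable if some $L^{[s]}=0$. The nilradical of $L$ is its maximal nilpotent (two-sided) ideal. The algebra $n_{n,1}$ is the Lie algebra with basis $\{e_1,\dots,e_n\}$ and products $[e_i,e_1]=-[e_1,e_i]=e_{i+1}$, $2\le i\le n-1$. For $\gamma_1,\gamma_2,\gamma_3\in\mathbb{C}$ with $(\gamma_1,\gamma_2,\gamma_3)\ne(0,0,0)$, $R_{n+1,1}(\gamma_1,\gamma_2,\gamma_3)$ denotes the algebra with basis $\{e_1,\dots,e_n,x\}$ and table of multiplication $$\begin{aligned} &[e_i,e_1]=-[e_1,e_i]=e_{i+1}, && 2\le i\le n-1,\\ &[e_1,x]=e_1, \qquad [x,e_1]=-e_1+\gamma_1 e_n,\\ &[e_2,x]=(2-n)e_2,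 \qquad [x,e_2]=(n-2)e_2+\gamma_2 e_n,\\ &[e_i,x]=-[x,e_i]=(i-n)e_i, && 3\le i\le n-1,\\ &[x,x]=\gamma_3 e_n. \end{aligned}$$ *)

(* Defs.v *)
From HB Require Import structures.
From mathcomp Require Import all_boot all_order all_algebra.
From mathcomp Require Export reals complex.

Set Implicit Arguments.
Unset Strict Implicit.
Unset Printing Implicit Defensive.

Import GRing.Theory.
Local Open Scope ring_scope.

(* An algebra over F is a vector space L : vectType F together with a bracket
   br : {bilinear L -> L -> L}. *)

Section AlgebraNotions.
Variables (F : fieldType) (L : vectType F).
Implicit Types (br : L -> L -> L) (U V N : {vspace L}).

Definition leibniz br :=
  forall x y z, br x (br y z) = br (br x y) z - br (br x z) y.

Definition lie br :=
  (forall x, br x x = 0) /\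
  (forall x y z, br x (br y z) + br y (br z x) + br z (br x y) = 0).

(* The span of all [u, v], u in U, v in V; for bilinear br, bases suffice. *)
Definition bracketv br U V : {vspace L} :=
  <<[seq br u v | u <- vbasis U, v <- vbasis V]>>%VS.

(* The indices are shifted: [lcs br U k] is U^{k+1}, and
   [dcs br U s] is U^{[s+1]}. *)
Definition lcs br U (k : nat) : {vspace L} := iter k (fun W => bracketv br W U) U.

Definition dcs br U (s : nat) : {vspace L} := iter s (fun W => bracketv br W W) U.

Definition nilpotent br U := exists k, lcs br U k = 0%VS.

Definition solvable br := exists s, dcs br fullv s = 0%VS.

Definition ideal br U := forall u x, u \in U -> br u x \in U /\ br x u \in U.

(* The induced bracket on N, meaningful when N is closed under br. *)
Definition subv_bracket br N (u v : subvs_of N) : subvs_of N :=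
  vsproj N (br (vsval u) (vsval v)).

Definition is_nilradical br N :=
  [/\ ideal br N, nilpotent br N
    & forall M : {vspace L},
        ideal br M -> nilpotent br M -> (N <= M)%VS -> M = N].

End AlgebraNotions.

Arguments subv_bracket {F L} br N u v.

Definition alg_iso (F : fieldType) (L M : vectType F)
    (brL : L -> L -> L) (brM : M -> M -> M) :=
  exists f : {linear L -> M},
    bijective f /\ forall x y, f (brL x y) = brM (f x) (f y).

Section StructureConstants.
Variables (F : fieldType) (m : nat).

(* Basis vectors are numbered from 1: e_1, ..., e_m is the standard basis
   of F^m. *)
Definition evec (k : nat) : 'rV[F]_m := \row_(j < m) (j.+1 == k)%:R.

(* The bilinear bracket with [e_i, e_j] = c i j for 1 <= i, j <= m. *)
Definition table_bracket (c : nat -> nat -> 'rV[F]_m) (u v : 'rV[F]_m) :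
    'rV[F]_m :=
  \sum_(i < m) \sum_(j < m) (u 0 i * v 0 j) *: c i.+1 j.+1.

Fact table_bracket_bilinear c :
  bilinear_for *:%R *:%R (table_bracket c).
Proof.
split=> [v|u] a x y; rewrite /applyr /table_bracket /= scaler_sumr -big_split /=;
  apply: eq_bigr => i _; rewrite scaler_sumr -big_split /=;
  apply: eq_bigr => j _; rewrite !mxE scalerA -scalerDl; congr (_ *: _).
  by rewrite mulrDl mulrA.
by rewrite mulrDr mulrCA.
Qed.

HB.instance Definition _ c :=
  bilinear_isBilinear.Build F 'rV[F]_m 'rV[F]_m 'rV[F]_m *:%R *:%R
    (table_bracket c) (table_bracket_bilinear c).

End StructureConstants.

Definition n1_table (F : fieldType) (n : nat) (i j : nat) : 'rV[F]_n :=
  let e := @evec F n in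
  if (j == 1)%N && (2 <= i <= n.-1)%N then e i.+1
  else if (i == 1)%N && (2 <= j <= n.-1)%N then - e j.+1
  else 0.

Definition n1_bracket (F : fieldType) (n : nat) := table_bracket (n1_table F n).

Arguments n1_bracket : clear implicits.

(* The basis vector x is e_{n+1}. *)
Definition R1_table (F : fieldType) (n : nat) (g1 g2 g3 : F) (i j : nat) :
    'rV[F]_n.+1 :=
  let e := @evec F n.+1 in
  let isx k := (k == n.+1)%N in
  if (j == 1)%N && (2 <= i <= n.-1)%N then e i.+1
  else if (i == 1)%N && (2 <= j <= n.-1)%N then - e j.+1
  else if (i == 1)%N && isx j then e 1%N
  else if isx i && (j == 1)%N then - e 1%N + g1 *: e n
  else if (i == 2)%N && isx j then (2%:R - n%:R) *: e 2
  else if isx i && (j == 2)%N then (n%:R - 2%:R) *: e 2 + g2 *: e n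
  else if (3 <= i <= n.-1)%N && isx j then (i%:R - n%:R) *: e i
  else if isx i && (3 <= j <= n.-1)%N then - ((j%:R - n%:R) *: e j)
  else if isx i && isx j then g3 *: e n
  else 0.

Definition R1_bracket (F : fieldType) (n : nat) (g1 g2 g3 : F) :=
  table_bracket (R1_table n g1 g2 g3).

Arguments R1_bracket : clear implicits.

(* Main.v *)
(* The nilradical N has codimension 1; let D be the right multiplication by a
   complementary vector x.  All squares [u, u] are annihilated by left
   multiplications, hence lie in the center <e_n> of N, and they span it since
   the algebra is not Lie; therefore [y, e_n] = 0 for all y, which forces
   D e_n = 0.  So D is triangular on N with diagonal a (1, 2 - n, ..., -1, 0),
   where a <> 0 because otherwise the whole algebra would be nilpotent.  After
   rescaling x to a = 1 the eigenvalues are distinct, and D has eigenvectors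
   e_1, e_2 generating N.  For an eigenvector e of eigenvalue l <> 0, the
   identity [x, [e, x]] = [[x, e], x] - [[x, x], e] gives [x, e] = - l e without
   any correction term: every algebra of the classification is in fact
   R_{n+1,1}(0,0,1), and the parameters gamma_1, gamma_2 only occur in
   non-Leibniz members of the list.

   For the pairwise non-isomorphism, an isomorphism between two members of the
   family has to respect the weights 1 and 2 - n of e_1 and e_2 modulo [N, N],
   so the vanishing of gamma_1 and of gamma_2, read off from
   [e_i, x] + [x, e_i] = gamma_i e_n, are both invariants. *)
Require Import Defs.
From HB Require Import structures.
From mathcomp Require Import all_boot all_order all_algebra.
From mathcomp Require Import reals complex.
From mathcomp Require Import zify ring.

Set Implicit Arguments.
Unset Strict Implicit.
Unset Printing Implicit Defensive.

Import GRing.Theory.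
Local Open Scope ring_scope.

(** * Structure constants *)

Section Tables.
Variables (F : fieldType) (m : nat).
Implicit Types (c : nat -> nat -> 'rV[F]_m) (u v : 'rV[F]_m).

Lemma evec_eq0 k : ~~ (1 <= k <= m)%N -> evec F m k = 0.
Proof.
move=> hk; apply/rowP=> j; rewrite !mxE; case: eqP => // jk.
by move: hk (ltn_ord j); lia.
Qed.

Lemma evec_ord (i j : 'I_m) : evec F m i.+1 0 j = (i == j)%:R.
Proof. by rewrite mxE eqSS eq_sym. Qed.

Lemma row_sum_evec u : u = \sum_(i < m) u 0 i *: evec F m i.+1.
Proof.
apply/rowP=> j; rewrite summxE (bigD1 j) //= mxE evec_ord eqxx mulr1 big1 ?addr0 //.
by move=> i /negPf nij; rewrite mxE evec_ord nij mulr0.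
Qed.

Lemma table_bracket_evec c i j :
  (1 <= i <= m)%N -> (1 <= j <= m)%N ->
  table_bracket c (evec F m i) (evec F m j) = c i j.
Proof.
case: i j => [|i] [|j] //= hi hj.
suff H (k l : 'I_m) :
  table_bracket c (evec F m k.+1) (evec F m l.+1) = c k.+1 l.+1.
  exact: (H (Ordinal hi) (Ordinal hj)).
rewrite /table_bracket (bigD1 k) //= [X in _ + X]big1 ?addr0 => [|p].
  rewrite (bigD1 l) //= !evec_ord !eqxx mulr1 scale1r big1 ?addr0 // => p.
  by rewrite !evec_ord eq_sym => /negPf ->; rewrite mulr0 scale0r.
rewrite eq_sym => /negPf nk; rewrite big1 // => q _.
by rewrite !evec_ord nk mul0r scale0r.
Qed.

End Tables.

Lemma alg_iso_sym (F : fieldType) (L M : vectType F)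
    (brL : L -> L -> L) (brM : M -> M -> M) :
  alg_iso brL brM -> alg_iso brM brL.
Proof.
move=> [f [[g fK gK] fM]].
have gl : linear g by move=> a x y; apply: (can_inj fK); rewrite linearP !gK.
pose gL : {linear M -> L} := HB.pack g (GRing.isLinear.Build _ _ _ _ g gl).
exists gL; split=> [|x y] /=; first by exists f.
by apply: (can_inj fK); rewrite fM !gK.
Qed.

Definition row_comb (F : fieldType) (L : vectType F) m (b : nat -> L) (u : 'rV[F]_m) : L :=
  \sum_(i < m) u 0 i *: b i.+1.

Section RowComb.
Variables (F : fieldType) (L : vectType F) (m : nat) (b : nat -> L).

Lemma row_comb_linear : linear (@row_comb F L m b).
Proof.
move=> c u v; rewrite /row_comb scaler_sumr -big_split; apply: eq_bigr => i _ /=.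
by rewrite !mxE scalerDl scalerA.
Qed.
HB.instance Definition _ :=
  GRing.isLinear.Build F 'rV[F]_m L *:%R (@row_comb F L m b) row_comb_linear.

Lemma row_comb_evec k : (1 <= k <= m)%N -> row_comb b (evec F m k) = b k.
Proof.
case: k => // k hk; rewrite /row_comb (bigD1 (Ordinal hk)) //= mxE eqxx scale1r.
rewrite big1 ?addr0 // => i /negPf ni; rewrite mxE eqSS.
by rewrite (_ : (i == k :> nat) = false) ?scale0r.
Qed.

(** A spanning family of [m] vectors in dimension [m] is a basis, so [row_comb b] is bijective, with
    [coord] as inverse. It starts from the row space, hence [alg_iso_sym]. *)
Lemma alg_iso_table (br : {bilinear L -> L -> L}) c :
  \dim {:L} = m ->
  (forall W : {vspace L}, (forall i, (1 <= i <= m)%N -> b i \in W) -> W = fullv) ->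
  (forall i j, (1 <= i <= m)%N -> (1 <= j <= m)%N ->
     br (b i) (b j) = row_comb b (c i j : 'rV[F]_m)) ->
  alg_iso br (table_bracket c).
Proof.
move=> dimL spanL brb; apply: alg_iso_sym.
pose X := [tuple b i.+1 | i < m].
have XE (i : 'I_m) : X`_i = b i.+1 by rewrite -tnth_nth tnth_mktuple.
have basX : basis_of fullv X.
  rewrite basisEdim size_tuple dimL leqnn andbT (spanL <<X>>%VS) //.
  case=> // k hk; have <- := XE (Ordinal hk); apply: memv_span.
  by rewrite mem_nth // size_tuple.
exists (row_comb b); split.
  exists (fun y => \row_i coord X i y) => [u|y].
    apply/rowP=> i; rewrite mxE /= /row_comb.
    rewrite (eq_bigr (fun j => u 0 j *: X`_j)) => [|j _]; last by rewrite XE.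
    by rewrite coord_sum_free // (basis_free basX).
  rewrite {2}(coord_basis basX (memvf y)); apply: eq_bigr => i _.
  by rewrite mxE XE.
move=> u v /=; rewrite /table_bracket linear_sum /= [row_comb b u]/row_comb linear_sumlz /=.
apply: eq_bigr => i _; rewrite linear_sum linearZl_LR /= [row_comb b v]/row_comb.
rewrite linear_sumr scaler_sumr; apply: eq_bigr => j _.
by rewrite linearZ /= linearZr_LR scalerA brb //= ltn_ord.
Qed.

End RowComb.

Lemma R1_recognition (F : fieldType) (L : vectType F) (br : {bilinear L -> L -> L})
    (n : nat) (b : nat -> L) :
  (4 <= n)%N -> \dim {:L} = n.+1 ->
  (forall W : {vspace L}, (forall i, (1 <= i <= n.+1)%N -> b i \in W) -> W = fullv) ->
  br (b 1) (b 1) = 0 -> br (b 1) (b n.+1) = b 1 -> br (b n.+1) (b 1) = - b 1 ->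
  br (b n.+1) (b n.+1) = b n ->
  (forall k, br (b k) (b n) = 0) -> (forall k, br (b n) (b k) = 0) ->
  (forall k, (2 <= k <= n.-1)%N -> br (b k) (b 1) = b k.+1) ->
  (forall k, (2 <= k <= n.-1)%N -> br (b 1) (b k) = - b k.+1) ->
  (forall k, (2 <= k <= n.-1)%N -> br (b k) (b n.+1) = (k%:R - n%:R) *: b k) ->
  (forall k, (2 <= k <= n.-1)%N -> br (b n.+1) (b k) = - ((k%:R - n%:R) *: b k)) ->
  (forall k l, (2 <= k <= n.-1)%N -> (2 <= l <= n.-1)%N -> br (b k) (b l) = 0) ->
  alg_iso br (R1_bracket F n 0 0 1).
Proof.
move=> hn dimL spanL r11 r1z rz1 rzz rkn rnk rk1 r1k rkz rzk rkl.
apply: (alg_iso_table dimL spanL) => i j hi hj.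
have cl k : (1 <= k <= n.+1)%N ->
    k = 1%N \/ k = 2%N \/ (3 <= k <= n.-1)%N \/ k = n \/ k = n.+1 by lia.
have be k : (1 <= k <= n.+1)%N -> row_comb b (evec F n.+1 k) = b k by exact: row_comb_evec.
have bD u v : row_comb b (u + v : 'rV[F]_n.+1) = row_comb b u + row_comb b v by exact: linearD.
have bN u : row_comb b (- u : 'rV[F]_n.+1) = - row_comb b u by exact: linearN.
have bZ c u : row_comb b (c *: u : 'rV[F]_n.+1) = c *: row_comb b u by exact: linearZ.
have b0 : row_comb b (0 : 'rV[F]_n.+1) = 0 by exact: linear0.
move: (@row_comb _ _ n.+1 b) be bD bN bZ b0 => f be bD bN bZ b0.
rewrite /R1_table.
case: (cl _ hi) => [->|[->|[{}hi|[->|->]]]];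
  case: (cl _ hj) => [->|[->|[{}hj|[->|->]]]].
all: rewrite ?rnk ?rkn ?r11 ?r1z ?rz1 ?rzz.
all: rewrite ?rk1 ?r1k ?rkz ?rzk ?rkl; try (clear -hn hi hj; lia).
all: clear -hn hi hj be bD bN bZ b0.
all: repeat match goal with |- context[if ?q then _ else _] =>
   first [ have -> : q = true by clear -hn hi hj; lia
         | have -> : q = false by clear -hn hi hj; lia] end.
all: rewrite ?bD ?bN ?bZ ?b0 ?be ?scale0r ?addr0 ?scale1r //; try (clear -hn hi hj; lia).
(* Only the product of [x] and [e_2] remains, where the table writes the weight as [n - 2]. *)
by rewrite -scaleNr opprB.
Qed.

(* Coordinates in F^{n+1} with the 1-based numbering of the tables. *)
Definition cf (F : fieldType) (n k : nat) (u : 'rV[F]_n.+1) : F := u 0 (inord k.-1).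

Section Coordinates.
Variables (F : fieldType) (n : nat).
Local Notation cf := (@cf F n).

Lemma cf_is_linear k : scalar (cf k).
Proof. by move=> a u v; rewrite /cf !mxE. Qed.
HB.instance Definition _ k :=
  GRing.isLinear.Build F 'rV[F]_n.+1 F *%R (cf k) (cf_is_linear k).

Lemma cf_evec k l : (1 <= k <= n.+1)%N -> cf k (evec F n.+1 l) = (k == l)%:R.
Proof. by case: k => // k hk; rewrite /cf mxE /= inordK. Qed.

Lemma sum_delta (u : 'rV[F]_n.+1) p : (1 <= p <= n.+1)%N ->
  \sum_(i < n.+1) u 0 i * (i.+1 == p)%:R = cf p u.
Proof.
case: p => // p hp; rewrite /cf (bigD1 (inord p)) //= inordK // eqxx mulr1.
rewrite big1 ?addr0 // => i /negPf; rewrite -val_eqE /= inordK // eqSS => ->.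
by rewrite mulr0.
Qed.

(** Puts a product of coordinates in the shape of [cf_table_bracket], so that identities between
    bilinear forms can be checked entrywise on the table. *)
Lemma sum_delta2 (u v : 'rV[F]_n.+1) p q :
  (1 <= p <= n.+1)%N -> (1 <= q <= n.+1)%N ->
  \sum_(i < n.+1) \sum_(j < n.+1) u 0 i * v 0 j * ((i.+1 == p) && (j.+1 == q))%:R
  = cf p u * cf q v.
Proof.
move=> hp hq; rewrite -(sum_delta u hp) -(sum_delta v hq) big_distrlr /=.
by apply: eq_bigr => i _; apply: eq_bigr => j _; rewrite -mulnb natrM; ring.
Qed.

Lemma cf_table_bracket k c (u v : 'rV[F]_n.+1) :
  cf k (table_bracket c u v) =
  \sum_(i < n.+1) \sum_(j < n.+1) u 0 i * v 0 j * cf k (c i.+1 j.+1).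
Proof.
rewrite linear_sum; apply: eq_bigr => i _.
by rewrite linear_sum; apply: eq_bigr => j _; rewrite linearZ.
Qed.

End Coordinates.

(** * The bracket of R_{n+1,1} in coordinates *)

Section R1.
Variables (F : fieldType) (n : nat) (g1 g2 g3 : F).
Hypothesis hn : (4 <= n)%N.
Local Notation e := (evec F n.+1).
Local Notation T := (R1_table n g1 g2 g3).
Local Notation B := (R1_bracket F n g1 g2 g3).
Local Notation cf := (@cf F n).

Ltac table_case :=
  move=> hi hj; rewrite /R1_table; repeat (case: ifP => ?);
  rewrite ?linearD ?linearN ?linearZ ?linear0 /= ?cf_evec ?leqnn //=;
  rewrite ?mulrb;
  repeat (case: ifP => ?; try by exfalso; lia);
  first [ring | lia].

Lemma cfx_table i j : (1 <= i <= n.+1)%N -> (1 <= j <= n.+1)%N ->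
  cf n.+1 (T i j) = 0.
Proof. by table_case. Qed.

Lemma cf1_table i j : (1 <= i <= n.+1)%N -> (1 <= j <= n.+1)%N ->
  cf 1 (T i j) = ((i == 1) && (j == n.+1))%:R - ((i == n.+1) && (j == 1))%:R.
Proof. by table_case. Qed.

Lemma cf2_table i j : (1 <= i <= n.+1)%N -> (1 <= j <= n.+1)%N ->
  cf 2 (T i j) =
  (2%:R - n%:R) * (((i == 2) && (j == n.+1))%:R - ((i == n.+1) && (j == 2))%:R).
Proof. by table_case. Qed.

(** The skew entries cancel and only the corrections along [e n] survive; [g3] is doubled because
    the entry of [x] with itself is added to itself. *)
Lemma table_sym i j : (1 <= i <= n.+1)%N -> (1 <= j <= n.+1)%N ->
  T i j + T j i =
  (g1 * (((i == 1) && (j == n.+1))%:R + ((i == n.+1) && (j == 1))%:R)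
   + g2 * (((i == 2) && (j == n.+1))%:R + ((i == n.+1) && (j == 2))%:R)
   + 2%:R * g3 * ((i == n.+1) && (j == n.+1))%:R) *: e n.
Proof.
move=> hi hj.
have cl k : (1 <= k <= n.+1)%N ->
    k = 1 \/ k = 2 \/ (3 <= k <= n.-1)%N \/ k = n \/ k = n.+1 by lia.
rewrite /R1_table !mulrb.
case: (cl _ hi) => [->|[->|[{}hi|[->|->]]]];
  case: (cl _ hj) => [->|[->|[{}hj|[->|->]]]];
  repeat match goal with |- context[if ?b then _ else _] =>
   first [have -> : b = true by lia | have -> : b = false by lia] end;
  apply/rowP=> l; rewrite !mxE; ring.
Qed.

Lemma cfx_R1 u v : cf n.+1 (B u v) = 0.
Proof.
rewrite cf_table_bracket big1 // => i _; rewrite big1 // => j _.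
by rewrite cfx_table ?ltn_ord // mulr0.
Qed.

Lemma cf1_R1 u v : cf 1 (B u v) = cf 1 u * cf n.+1 v - cf n.+1 u * cf 1 v.
Proof.
rewrite cf_table_bracket -!sum_delta2 ?leqnn // -sumrB.
apply: eq_bigr => i _; rewrite -sumrB; apply: eq_bigr => j _.
by rewrite cf1_table ?ltn_ord // mulrBr.
Qed.

Lemma cf2_R1 u v : cf 2 (B u v) =
  (2%:R - n%:R) * (cf 2 u * cf n.+1 v - cf n.+1 u * cf 2 v).
Proof.
have h2 : (1 <= 2 <= n.+1)%N by lia.
rewrite cf_table_bracket -!sum_delta2 ?leqnn // -sumrB mulr_sumr.
apply: eq_bigr => i _; rewrite -sumrB mulr_sumr; apply: eq_bigr => j _.
by rewrite cf2_table ?ltn_ord //; ring.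
Qed.

Lemma R1_sym u v : B u v + B v u =
  (g1 * (cf 1 u * cf n.+1 v + cf n.+1 u * cf 1 v)
   + g2 * (cf 2 u * cf n.+1 v + cf n.+1 u * cf 2 v)
   + 2%:R * g3 * (cf n.+1 u * cf n.+1 v)) *: e n.
Proof.
have h2 : (1 <= 2 <= n.+1)%N by lia.
have -> : B v u = \sum_(i < n.+1) \sum_(j < n.+1) (v 0 j * u 0 i) *: T j.+1 i.+1.
  exact: exchange_big.
rewrite -!sum_delta2 ?leqnn // -!big_split /= !mulr_sumr -!big_split /= scaler_suml.
apply: eq_bigr => i _; rewrite -!big_split /= !mulr_sumr -!big_split /= scaler_suml.
apply: eq_bigr => j _; rewrite [v 0 j * _]mulrC -scalerDr table_sym ?ltn_ord //.
by rewrite scalerA; congr (_ *: _); ring.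
Qed.

End R1.

(** * Isomorphisms between the algebras R_{n+1,1} *)

(* A weight-preserving map of the plane <e_1, e_2> with weights 1 and 2 - n, up
   to a rescaling of the weights by tau: it cannot exchange the two lines. *)
Lemma weight_rigidity (F : fieldType) (n : nat) (p1 p2 r1 r2 y1 y2 z1 z2 tau : F) :
  [pchar F] =i pred0 -> (4 <= n)%N ->
  p1 = p1 * tau -> p2 = (2%:R - n%:R) * (p2 * tau) ->
  (2%:R - n%:R) * r1 = r1 * tau -> r2 = r2 * tau ->
  y1 * p1 + y2 * r1 = 1 -> z1 * p2 + z2 * r2 = 1 ->
  [/\ tau = 1, p2 = 0, r1 = 0, p1 != 0 & r2 != 0].
Proof.
move=> /pcharf0P F0 hn e1 e2 e3 e4 hy hz.
have n1 : n%:R - 1%:R != 0 :> F by rewrite -natrB ?F0; lia.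
have n3 : n%:R - 3%:R != 0 :> F by rewrite -natrB ?F0; lia.
(* If [tau] is not 1, then [p1 = r2 = 0], so [r1] and [p2] are nonzero: the lines are exchanged and
   [tau = 2 - n]. *)
have tau1 : tau = 1.
  apply/eqP/negPn/negP; rewrite -subr_eq0 => tau1.
  have p10 : p1 = 0 by apply: (mulIf tau1); rewrite mulrBr -e1; ring.
  have r20 : r2 = 0 by apply: (mulIf tau1); rewrite mulrBr -e4; ring.
  have r1n : r1 != 0.
    by apply/eqP => r0; move: hy; rewrite p10 r0 !mulr0 addr0 => /esym/eqP; rewrite oner_eq0.
  have p2n : p2 != 0.
    by apply/eqP => p0; move: hz; rewrite p0 r20 !mulr0 addr0 => /esym/eqP; rewrite oner_eq0.
  have et : tau = 2%:R - n%:R by apply: (mulIf r1n); rewrite mulrC -e3.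
  (* The two weight equations give (2 - n)^2 = 1, that is (n - 1)(n - 3) = 0, impossible for n >=
     4. *)
  have : (n%:R - 1%:R) * (n%:R - 3%:R) * p2 = 0.
    transitivity ((2%:R - n%:R) * (p2 * tau) - p2); first by rewrite et; ring.
    by rewrite -e2 subrr.
  by apply/eqP; rewrite !mulf_neq0.
have p20 : p2 = 0.
  apply: (mulfI n1); rewrite mulr0.
  transitivity (p2 - (2%:R - n%:R) * (p2 * tau)); first by rewrite tau1; ring.
  by rewrite -e2 subrr.
have r10 : r1 = 0.
  apply: (mulfI n1); rewrite mulr0.
  transitivity (r1 * tau - (2%:R - n%:R) * r1); first by rewrite tau1; ring.
  by rewrite -e3 subrr.
split=> //.
  by apply/eqP => p0; move: hy; rewrite p0 r10 !mulr0 addr0 => /esym/eqP; rewrite oner_eq0.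
by apply/eqP => r0; move: hz; rewrite p20 r0 !mulr0 addr0 => /esym/eqP; rewrite oner_eq0.
Qed.

(** Applying [f] to [e_i, x] + [x, e_i] = g_i e_n gives a nonzero multiple of h_i times e_n for i =
    1, 2, once [f] is known to be diagonal on e_1, e_2 modulo e_3, ..., e_n. *)
Lemma R1_iso_gamma (F : fieldType) (n : nat) (g1 g2 g3 h1 h2 h3 : F) :
  [pchar F] =i pred0 -> (4 <= n)%N ->
  alg_iso (R1_bracket F n g1 g2 g3) (R1_bracket F n h1 h2 h3) ->
  (g1 == 0) = (h1 == 0) /\ (g2 == 0) = (h2 == 0).
Proof.
move=> pF0 hn [f [[finv fK finvK] fB]].
set e := evec F n.+1; set x := e n.+1.
pose t := @cf F n n.+1; pose c1 := @cf F n 1; pose c2 := @cf F n 2.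
have hn2 : (1 <= 2 <= n.+1)%N by lia.
have cfZ k a u : @cf F n k (a *: u) = a * cf k u by exact: linearZ.
have /pcharf0P F0 := pF0.
have T i j : (1 <= i <= n.+1)%N -> (1 <= j <= n.+1)%N ->
  R1_bracket F n g1 g2 g3 (e i) (e j) = R1_table n g1 g2 g3 i j.
  exact: table_bracket_evec.
have n2 : 2%:R - n%:R != 0 :> F.
  by rewrite -opprB oppr_eq0 -natrB ?F0; lia.
have f1 : f (e 1) = R1_bracket F n h1 h2 h3 (f (e 1)) (f x).
  rewrite -fB T; [congr (f _)|lia|lia]; rewrite /R1_table.
  by repeat (case: ifP => ?; try by exfalso; lia).
have f2 : (2%:R - n%:R) *: f (e 2) = R1_bracket F n h1 h2 h3 (f (e 2)) (f x).
  rewrite -fB T; [rewrite -linearZ; congr (f _)|lia|lia]; rewrite /R1_table.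
  by repeat (case: ifP => ?; try by exfalso; lia).
have fe i : (3 <= i <= n)%N ->
    f (e i) = R1_bracket F n h1 h2 h3 (f (e i.-1)) (f (e 1)).
  move=> hi; rewrite -fB T; [congr (f _)|lia|lia]; rewrite /R1_table.
  case: ifP => hh; first by congr (e _); lia.
  by exfalso; lia.
have t1 : t (f (e 1)) = 0 by rewrite f1 /t cfx_R1.
have t2 : t (f (e 2)) = 0.
  by apply: (mulfI n2); rewrite mulr0 -cfZ f2 /t cfx_R1.
have ti i : (1 <= i <= n)%N -> t (f (e i)) = 0.
  case: i => [|[|[|i]]] // hi; rewrite fe; last by lia.
  by rewrite /t cfx_R1.
have ci i : (3 <= i <= n)%N -> c1 (f (e i)) = 0 /\ c2 (f (e i)) = 0.
  move=> hi; rewrite fe //; rewrite /c1 /c2 cf1_R1 // cf2_R1 //.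
  by rewrite -/t !ti; [split; ring|lia|lia].
(* When the images of e_3, ..., e_n have no [k]-th coordinate, that of [f y] depends only on the
   coordinates of [y] along e_1, e_2 and x. *)
have expand k y :
    (forall i, (3 <= i <= n)%N -> cf k (f (e i)) = 0) ->
    cf k (f y) = cf 1 y * cf k (f (e 1)) + cf 2 y * cf k (f (e 2)) + t y * cf k (f x).
  move=> cf0; rewrite {1}[y]row_sum_evec !linear_sum /=.
  rewrite /t -!(sum_delta y) ?leqnn // !mulr_suml -!big_split /=.
  apply: eq_bigr => i _; rewrite !linearZ /= -/(e _) !mulrb.
  have hi := ltn_ord i.
  repeat (case: eqP => ?; try by exfalso; lia); rewrite ?mulr0 ?mul0r ?mulr1.
  - by rewrite (_ : i.+1 = 1%N); [ring|lia].
  - by rewrite (_ : i.+1 = 2%N); [ring|lia].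
  - by rewrite (_ : i.+1 = n.+1); [rewrite /x; ring|lia].
  by rewrite cf0; [ring|lia].
have tf y : t (f y) = t y * t (f x).
  rewrite [LHS]expand => [|i hi]; last by apply: ti; lia.
  by rewrite /= -/t t1 t2; ring.
(* [tau] is the scalar by which [f] acts modulo the span of e_1, ..., e_n. *)
set tau := t (f x) in tf *.
have tau0 : tau != 0.
  have := tf (finv x); rewrite finvK /t cf_evec ?leqnn // eqxx => h.
  by apply/eqP => t0; move: h; rewrite t0 mulr0 => /eqP; rewrite oner_eq0.
have tfinv i : (1 <= i <= n)%N -> t (finv (e i)) = 0.
  move=> hi; apply: (mulIf tau0); rewrite -tf finvK mul0r /t cf_evec ?leqnn //.
  by case: eqP => // ?; exfalso; lia.
(* The matrix of [f] on e_1, e_2 modulo e_3, ..., e_n; the preimages of e_1 and e_2 supply the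
   coefficients [y] and [z] of [weight_rigidity]. *)
pose p1 := c1 (f (e 1)); pose p2 := c2 (f (e 1)).
pose r1 := c1 (f (e 2)); pose r2 := c2 (f (e 2)).
have c1_finv i : (1 <= i <= n)%N ->
    cf 1 (finv (e i)) * p1 + cf 2 (finv (e i)) * r1 = (1 == i)%:R.
  move=> hi; have := expand 1%N (finv (e i)); rewrite finvK tfinv // cf_evec // => ->.
    by ring.
  by move=> k hk; case: (ci k hk).
have c2_finv i : (1 <= i <= n)%N ->
    cf 1 (finv (e i)) * p2 + cf 2 (finv (e i)) * r2 = (2 == i)%:R.
  move=> hi; have := expand 2%N (finv (e i)); rewrite finvK tfinv // cf_evec // => ->.
    by ring.
  by move=> k hk; case: (ci k hk).
have e1 : p1 = p1 * tau.
  by rewrite {1}/p1 /c1 f1 cf1_R1 // -/t t1 mul0r subr0.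
have e2 : p2 = (2%:R - n%:R) * (p2 * tau).
  by rewrite {1}/p2 /c2 f1 cf2_R1 // -/t t1 mul0r subr0.
have e3 : (2%:R - n%:R) * r1 = r1 * tau.
  by rewrite -cfZ f2 /c1 cf1_R1 // -/t t2 mul0r subr0.
have e4 : r2 = r2 * tau.
  by apply: (mulfI n2); rewrite -cfZ f2 cf2_R1 // -/t t2 mul0r subr0.
have [tau1 p20 r10 p1n r2n] : [/\ tau = 1, p2 = 0, r1 = 0, p1 != 0 & r2 != 0].
  apply: (weight_rigidity pF0 hn e1 e2 e3 e4 (c1_finv 1%N _) (c2_finv 2%N _)); lia.
have en0 : e n != 0.
  apply/eqP => /(congr1 (cf n)) /eqP; rewrite cf_evec; last by lia.
  by rewrite eqxx [cf n 0]linear0 oner_eq0.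
have fn0 : f (e n) != 0.
  apply/eqP => h; case/eqP: en0; apply: (can_inj fK); rewrite h linear0 //.
have eqF : ((1 == n.+1) = false) * ((n.+1 == 1) = false) * ((2 == n.+1) = false) *
    ((n.+1 == 2) = false) by split; [split; [split|]|]; lia.
have q1 : R1_bracket F n g1 g2 g3 (e 1) x + R1_bracket F n g1 g2 g3 x (e 1) = g1 *: e n.
  rewrite R1_sym // /x /e !cf_evec ?leqnn ?eqxx ?eqF //=.
  by congr (_ *: _); ring.
have q2 : R1_bracket F n g1 g2 g3 (e 2) x + R1_bracket F n g1 g2 g3 x (e 2) = g2 *: e n.
  rewrite R1_sym // /x /e !cf_evec ?leqnn ?eqxx ?eqF //=.
  by congr (_ *: _); ring.
(* As [f (e 1)] has no coordinate along x and [p2 = 0], only the [h1] term of [R1_sym] survives. *)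
have s1 : g1 *: f (e n) = (h1 * p1) *: e n.
  rewrite -[LHS]linearZ -q1 linearD !fB R1_sym // -/t t1 -/tau tau1.
  by rewrite -/(c2 (f (e 1))) -/p2 p20 -/(c1 (f (e 1))) -/p1; congr (_ *: _); ring.
have s2 : g2 *: f (e n) = (h2 * r2) *: e n.
  rewrite -[LHS]linearZ -q2 linearD !fB R1_sym // -/t t2 -/tau tau1.
  by rewrite -/(c2 (f (e 2))) -/r2 -/(c1 (f (e 2))) -/r1 r10; congr (_ *: _); ring.
have sE (g h p : F) : p != 0 -> g *: f (e n) = (h * p) *: e n -> (g == 0) = (h == 0).
  move=> p0 h0; have : (g *: f (e n) == 0) = ((h * p) *: e n == 0) by rewrite h0.
  by rewrite !scaler_eq0 (negPf fn0) (negPf en0) !orbF mulf_eq0 (negPf p0) orbF.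
by split; [apply: sE s1|apply: sE s2].
Qed.

(** * The filtration of the nilradical *)

Section Tail.
Variables (F : fieldType) (L : vectType F) (n : nat) (a : nat -> L).
Hypothesis a_big : forall i, (n < i)%N -> a i = 0.

(** The span of a_k, ..., a_n. Truncated subtraction makes it zero for k > n, in agreement with
    [a_big], so shifts of the index need no upper bound. *)
Definition tail k : {vspace L} := <<[seq a i | i <- iota k (n.+1 - k)]>>%VS.

Lemma tail_big k : (n < k)%N -> tail k = 0%VS.
Proof. by move=> hk; rewrite /tail (eqP (_ : n.+1 - k == 0)%N) ?span_nil. Qed.

Lemma tail_cons k : tail k = (<[a k]> + tail k.+1)%VS.
Proof.
have [hk|hk] := leqP k n; last first.
  by rewrite a_big // !tail_big // ?addv0 //; lia.
by rewrite /tail subSn //= span_cons subSS.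
Qed.

Lemma tail_sub k l : (k <= l)%N -> (tail l <= tail k)%VS.
Proof.
move=> /subnKC <-; elim: (l - k)%N => [|d IH]; first by rewrite addn0.
by apply: subv_trans IH; rewrite addnS [tail (k + d)]tail_cons addvSr.
Qed.

Lemma tailW k l v : (k <= l)%N -> v \in tail l -> v \in tail k.
Proof. by move=> /tail_sub /subvP; apply. Qed.

Lemma mem_tail k i : (k <= i)%N -> a i \in tail k.
Proof.
by move=> ki; apply: (tailW ki); rewrite tail_cons; exact: (subvP (addvSl _ _)) _ (memv_line _).
Qed.

Lemma tail_split k v : v \in tail k -> exists c, v - c *: a k \in tail k.+1.
Proof.
rewrite tail_cons => /memv_addP[_ /vlineP[c ->] [w hw ->]].
by exists c; rewrite addrC addKr.
Qed.

Lemma tail_ind (P : L -> Prop) k :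
  P 0 -> (forall c u v, P u -> P v -> P (c *: u + v)) ->
  (forall i, (k <= i)%N -> (i <= n)%N -> P (a i)) ->
  forall v, v \in tail k -> P v.
Proof.
move=> P0 PL; have [d] := ubnP (n.+1 - k); elim: d k => // d IH k hd Pa v hv.
have [hk|hk] := ltnP n k.
  by move: hv; rewrite tail_big // memv0 => /eqP ->.
have [c hw] := tail_split hv.
rewrite -[v](subrKC (c *: a k)); apply: PL; first exact: Pa.
by apply: IH hw; [lia | move=> i hi; apply: Pa; lia].
Qed.

Lemma tail_line v : v \in tail n -> exists c, v = c *: a n.
Proof.
move=> /tail_split[c]; rewrite tail_big // memv0 subr_eq0 => /eqP ->.
by exists c.
Qed.

End Tail.

(** * Non-Lie Leibniz extensions of n_{n,1} *)

Lemma eqr_nat_pchar0 (F : fieldType) p q :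
  [pchar F] =i pred0 -> (p%:R == q%:R :> F) = (p == q).
Proof.
move=> /pcharf0P F0; wlog pq : p q / (p <= q)%N => [H|].
  by have [/H//|/ltnW/H] := leqP p q; rewrite eq_sym => ->; rewrite eq_sym.
by rewrite eq_sym -subr_eq0 -natrB // F0 subn_eq0 eqn_leq pq.
Qed.

Section Leibniz.
Variables (F : fieldType) (L : vectType F) (br : {bilinear L -> L -> L}).
Hypothesis leib : leibniz br.

(** The Leibniz identity read as: right multiplications are derivations. *)
Lemma leibniz_derivation u v y : br (br u v) y = br u (br v y) + br (br u y) v.
Proof. by rewrite leib subrK. Qed.

Lemma leibniz_sq_right y u : br y (br u u) = 0.
Proof. by rewrite leib subrr. Qed.

(** Polarisation gives antisymmetry, which turns the Leibniz identity into the Jacobi identity. *)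
Lemma leibniz_sq0_lie : (forall u, br u u = 0) -> lie br.
Proof.
move=> sq0; split=> // x y z.
have anti u v : br u v = - br v u.
  have := sq0 (u + v); rewrite linearDl !linearDr /= !sq0 add0r addr0.
  by move=> /eqP; rewrite addr_eq0 => /eqP.
by rewrite leib [br (br x y) z]anti [br (br x z) y]anti [br x z]anti linearNr opprK subrK addNr.
Qed.

End Leibniz.

Lemma bracketv_subP (F : fieldType) (L : vectType F) (br : L -> L -> L) (U W X : {vspace L}) :
  (forall u v, u \in U -> v \in W -> br u v \in X) -> (bracketv br U W <= X)%VS.
Proof.
move=> h; apply/span_subvP => _ /allpairsP[[u v] /= [hu hv ->]].
by apply: h; apply: vbasis_mem.
Qed.

(** * The filtration [V k] under the bracket of n_{n,1} *)

Section Chain.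
Variables (F : fieldType) (L : vectType F) (br : {bilinear L -> L -> L}).
Variables (n : nat) (a : nat -> L).
Local Notation V := (tail n a).
Hypothesis hn : (4 <= n)%N.
Hypothesis a_big : forall i, (n < i)%N -> a i = 0.
Hypothesis a_free : forall k c, (1 <= k <= n)%N -> c *: a k \in V k.+1 -> c = 0.
Hypothesis a11 : br (a 1) (a 1) = 0.
Hypothesis ai1 : forall i, (2 <= i)%N -> br (a i) (a 1) = a i.+1.
Hypothesis a1i : forall i, (2 <= i)%N -> br (a 1) (a i) = - a i.+1.
Hypothesis aij : forall i j, (2 <= i)%N -> (2 <= j)%N -> br (a i) (a j) = 0.

Lemma tail22 u v : u \in V 2 -> v \in V 2 -> br u v = 0.
Proof.
move=> hu hv; move: u hu.
apply: (tail_ind a_big) => [|c u u' hu hu'|i hi _]; first by rewrite linear0l.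
  by rewrite linearPl hu hu' scaler0 addr0.
move: v hv; apply: (tail_ind a_big) => [|c v v' hv hv'|j hj _]; first by rewrite linear0r.
  by rewrite linearPr hv hv' scaler0 addr0.
exact: aij.
Qed.

Lemma tail_br_a1 k v : (2 <= k)%N -> v \in V k -> br v (a 1) \in V k.+1.
Proof.
move=> hk; move: v; apply: (tail_ind a_big) => [|c u u' hu hu'|i hi _].
- by rewrite linear0l mem0v.
- by rewrite linearPl memvD ?memvZ.
by rewrite ai1 ?mem_tail //; lia.
Qed.

Lemma tail_anti u v : u \in V 1 -> v \in V 1 -> br u v = - br v u.
Proof.
move=> hu hv; move: u hu; apply: (tail_ind a_big) => [|c u u' hu hu'|i hi _].
- by rewrite linear0l linear0r oppr0.
- by rewrite linearPl linearPr hu hu' opprD scalerN.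
move: v hv; apply: (tail_ind a_big) => [|c v v' hv hv'|j hj _].
- by rewrite linear0l linear0r oppr0.
- by rewrite linearPl linearPr hv hv' opprD scalerN.
have [->|i1] := eqVneq i 1%N; have [->|j1] := eqVneq j 1%N.
- by rewrite a11 oppr0.
- by rewrite ai1 ?a1i //; lia.
- by rewrite ai1 ?a1i ?opprK //; lia.
- by rewrite !aij ?oppr0 //; lia.
Qed.

Lemma tail_br k v w : (2 <= k)%N -> v \in V k -> w \in V 1 -> br v w \in V k.+1.
Proof.
move=> hk hv /(tail_split a_big)[c hw]; rewrite -[w](subrKC (c *: a 1)).
rewrite linearDr linearZr_LR (tail22 _ hw) ?addr0 ?(tailW a_big _ hv) //.
by rewrite memvZ ?tail_br_a1.
Qed.

(** The index jumps by two because [a_1, a_1] = 0 and every other product lies in the span of a_3,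
    ..., a_n. *)
Lemma tail_br1 v w : v \in V 1 -> w \in V 1 -> br v w \in V 3.
Proof.
move=> hv hw; have [c hv'] := tail_split a_big hv; have [d hw'] := tail_split a_big hw.
rewrite -[v](subrKC (c *: a 1)) linearDl /=; apply: memvD; last exact: (tail_br (k := 2)).
have a1V : a 1 \in V 1 by exact: mem_tail.
rewrite linearZl_LR memvZ //= tail_anti // memvN -[w](subrKC (d *: a 1)) linearDl /=.
apply: memvD; last exact: (tail_br (k := 2)).
by rewrite linearZl_LR /= a11 scaler0 mem0v.
Qed.

Lemma tail_center s : s \in V 1 -> (forall y, br y s = 0) -> s \in V n.
Proof.
move=> s1 ann.
suff : forall k, (1 <= k)%N -> (k <= n)%N -> s \in V k by move=> /(_ n); apply; lia.
elim=> // k IH _ hk.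
have [->//|k1] := posnP k.
have [c hc] := tail_split a_big (IH k1 (ltnW hk)).
suff c0 : c = 0 by rewrite c0 scale0r subr0 in hc.
have [k2|k2] : k = 1%N \/ (2 <= k)%N by lia.
  (* Bracketing with [a 2] isolates the coefficient of [a 1]; for k >= 2, bracketing with [a 1]
     shifts the leading term to [a k.+1], nonzero as k < n. *)
  subst k; apply: (@a_free 3); first by lia.
  have := ann (a 2); rewrite -{1}[s](subrKC (c *: a 1)) linearDr linearZr_LR /=.
  by rewrite ai1 // (tail22 _ hc) ?mem_tail // addr0 => ->; rewrite mem0v.
apply: (@a_free k.+1); first by lia.
have := tail_br_a1 (k := k.+1) _ hc.
rewrite tail_anti ?mem_tail ?(tailW a_big _ hc) // linearBr ann sub0r opprK.
by rewrite linearZr_LR /= a1i // scalerN memvN; apply; lia.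
Qed.

(** * Squares, and brackets with a complement [x] of the nilradical *)

Hypothesis leib : leibniz br.
Hypothesis nlie : ~ lie br.
Hypothesis V1_ideal : ideal br (V 1).
Variable x : L.
Hypothesis xV1 : x \notin V 1.
Hypothesis codim1 : forall y, exists t, y - t *: x \in V 1.

(** Only [x, x] is in question. If it equals w + t x with w in [V 1], then [x, [x, x]] = 0 gives t
    [x, x] = - [x, w], which lies in the ideal [V 1]; so [x, x] does too, whether or not t = 0. *)
Lemma bracket_tail1 u v : br u v \in V 1.
Proof.
have xx : br x x \in V 1.
  have [t ht] := codim1 (br x x).
  have := leibniz_sq_right leib x x.
  rewrite -{1}[br x x](subrK (t *: x)) linearDr linearZr_LR /= => /eqP.
  rewrite addrC addr_eq0 => /eqP e.
  have [t0|t0] := eqVneq t 0; first by move: ht; rewrite t0 scale0r subr0.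
  have : t *: br x x \in V 1 by rewrite e memvN; case: (V1_ideal x ht).
  by move/(memvZ t^-1); rewrite scalerA mulVf // scale1r.
have [s hs] := codim1 u; have [t ht] := codim1 v.
rewrite -[u](subrK (s *: x)) linearDl /=; apply: memvD; first by case: (V1_ideal v hs).
rewrite linearZl_LR memvZ //= -[v](subrK (t *: x)) linearDr; apply: memvD.
  by case: (V1_ideal x ht).
by rewrite linearZr_LR memvZ.
Qed.

Lemma sq_tail u : br u u \in V n.
Proof.
by apply: tail_center; [exact: bracket_tail1 | move=> y; exact: leibniz_sq_right].
Qed.

Lemma sym_tail u v : br u v + br v u \in V n.
Proof.
have -> : br u v + br v u = br (u + v) (u + v) - br u u - br v v.
  rewrite linearDl !linearDr /= addrAC addrA addrK -(addrA (br u u)).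
  by rewrite [br u u + _]addrC addrK.
by rewrite !memvB ?sq_tail.
Qed.

(** Every square is some c a_n and is killed by [y, -]. If [y, a_n] were nonzero, all these c would
    vanish and the algebra would be Lie. *)
Lemma br_an_right y : br y (a n) = 0.
Proof.
apply/eqP/negPn/negP => ny; apply: nlie; apply: leibniz_sq0_lie => // u.
have [c e] := tail_line a_big (sq_tail u); rewrite e.
have /eqP := leibniz_sq_right leib y u.
by rewrite e linearZr_LR scaler_eq0 (negPf ny) orbF => /eqP ->; rewrite scale0r.
Qed.

Lemma br_tailn_right y v : v \in V n -> br y v = 0.
Proof. by move/(tail_line a_big) => [c ->]; rewrite linearZr_LR br_an_right scaler0. Qed.

(** Expand [y, a_n] with a_n = [a_{n-1}, a_1]. Swapping y with a_{n-1} and with a_1 changes the sign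
    up to [V n], which is central in [V 1]; the derivation rule then yields [y, a_n] = -
    [a_n, y]. *)
Lemma br_an_left y : br (a n) y = 0.
Proof.
have anE : a n = br (a n.-1) (a 1) by rewrite ai1; [congr a|]; lia.
have aV i : (1 <= i)%N -> a i \in V 1 by exact: mem_tail.
have h1 : br (br y (a n.-1)) (a 1) = - br (br (a n.-1) y) (a 1).
  apply/eqP; rewrite -addr_eq0 -linearDl /=; apply/eqP.
  rewrite tail_anti ?(tailW a_big _ (sym_tail _ _)) ?aV //; last by lia.
  by rewrite br_tailn_right ?sym_tail ?oppr0.
have h2 : br (br y (a 1)) (a n.-1) = - br (br (a 1) y) (a n.-1).
  apply/eqP; rewrite -addr_eq0 -linearDl /=; apply/eqP.
  rewrite tail_anti ?(tailW a_big _ (sym_tail _ _)) ?aV //; [|lia|lia].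
  by rewrite br_tailn_right ?sym_tail ?oppr0.
apply/eqP; rewrite -oppr_eq0; apply/eqP.
rewrite -[RHS](br_an_right y) {2}anE leib h1 h2 {1}anE (leibniz_derivation leib).
rewrite [br (a n.-1) _]tail_anti ?aV ?bracket_tail1 //; last by lia.
by rewrite opprD !opprK addrC.
Qed.

(** Right multiplication by [x] is a derivation, so its leading terms on a_1 and a_2 fix those on
    all a_{i+1} = [a_i, a_1]. *)
Lemma weights_exist : exists alpha beta,
  [/\ br (a 1) x - alpha *: a 1 \in V 2
    & forall i, (2 <= i)%N -> br (a i) x - (beta + (i - 2)%:R * alpha) *: a i \in V i.+1].
Proof.
have aV i : (1 <= i)%N -> a i \in V 1 by exact: mem_tail.
have [alpha h1] := tail_split a_big (bracket_tail1 (a 1) x).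
have [b1 h2] := tail_split a_big (bracket_tail1 (a 2) x).
have step i : (2 <= i)%N ->
    br (a i.+1) x = br (a i) (br (a 1) x) + br (br (a i) x) (a 1).
  by move=> hi; rewrite -ai1 // (leibniz_derivation leib).
have stepa i : (2 <= i)%N -> br (a i) (br (a 1) x) = alpha *: a i.+1.
  move=> hi; rewrite -[br (a 1) x](subrKC (alpha *: a 1)) linearDr linearZr_LR /=.
  by rewrite ai1 // (tail22 _ h1) ?mem_tail // addr0.
(* Applying the derivation to [a_2, a_3] = 0 leaves - b1 a_4 = 0, and a_4 is nonzero since n >=
   4. *)
have b10 : b1 = 0.
  have h3 : br (a 3) x \in V 2.
    rewrite step // stepa // memvD ?memvZ ?mem_tail //.
    rewrite -[br (a 2) x](subrKC (b1 *: a 1)) linearDl linearZl_LR /= a11 scaler0 add0r.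
    by rewrite (tailW a_big _ (tail_br_a1 _ h2)).
  apply: (@a_free 4); first by lia.
  have := leibniz_derivation leib (a 2) (a 3) x.
  rewrite aij // linear0l (tail22 _ h3) ?mem_tail // add0r.
  rewrite -[br (a 2) x](subrKC (b1 *: a 1)) linearDl linearZl_LR /=.
  rewrite (tail22 h2) ?mem_tail // addr0 a1i // scalerN => /eqP.
  by rewrite eq_sym oppr_eq0 => /eqP ->; rewrite mem0v.
rewrite b10 scale0r subr0 in h2.
have [beta h3] := tail_split a_big h2.
exists alpha, beta; split=> // i hi; rewrite -(subnKC hi).
elim: (i - 2)%N => [|d IH]; first by rewrite mul0r addr0.
rewrite [(2 + d.+1)%N]addnS step ?stepa //; set k := (2 + d)%N in IH *.
have hk : (2 <= k)%N by [].
have -> : (k.+1 - 2)%N = (k - 2).+1 by rewrite /k; lia.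
have := tail_br_a1 (k := k.+1) _ IH; rewrite linearBl linearZl_LR /= ai1 // => /(_ isT).
set u := br (br (a k) x) (a 1); set b := beta + _.
suff -> : alpha *: a k.+1 + u - (beta + (k - 2).+1%:R * alpha) *: a k.+1 = u - b *: a k.+1.
  by [].
rewrite -natr1 mulrDl mul1r addrA scalerDl opprD.
by rewrite [alpha *: _ + _]addrC addrA addrAC addrK.
Qed.

Lemma nilpotent_full :
  br (a 1) x \in V 2 -> (forall i, (2 <= i)%N -> br (a i) x \in V i.+1) ->
  nilpotent br fullv.
Proof.
move=> h1 hi.
have Vx k v : (1 <= k)%N -> v \in V k -> br v x \in V k.+1.
  move=> hk; move: v; apply: (tail_ind a_big) => [|c u u' hu hu'|i ki _].
  - by rewrite linear0l mem0v.
  - by rewrite linearPl memvD ?memvZ.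
  have [i1|i2] : i = 1%N \/ (2 <= i)%N by lia.
    by subst i; apply: (tailW a_big _ h1); lia.
  by apply: (tailW a_big _ (hi i i2)); lia.
have VL k v y : (1 <= k)%N -> v \in V k -> br v y \in V k.+1.
  move=> hk hv; have [t ht] := codim1 y.
  rewrite -[y](subrK (t *: x)) linearDr linearZr_LR; apply: memvD; last by rewrite memvZ ?Vx.
  have [k1|k2] : k = 1%N \/ (2 <= k)%N by lia.
    by subst k; apply: (tailW a_big (k := 2) (l := 3)); rewrite ?tail_br1.
  exact: tail_br.
(* The first bracket lands in [V 1] and each further one moves a step down, so [lcs br fullv k.+1]
   lies in [V k.+1]. *)
exists n.+1; apply/eqP; rewrite -subv0 -(@tail_big _ _ n a n.+1) //.
elim: {1 3}n => [|k IH]; first by apply: bracketv_subP => u v _ _; exact: bracket_tail1.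
by apply: bracketv_subP => u v hu _; apply: VL => //; exact: (subvP IH).
Qed.

Hypothesis V1_max : forall M : {vspace L},
  ideal br M -> nilpotent br M -> (V 1 <= M)%VS -> M = V 1.

Lemma normalized_exist : exists z, [/\ z \notin V 1,
  forall y, exists t, y - t *: z \in V 1,
  br (a 1) z - a 1 \in V 2
  & forall i, (2 <= i)%N -> br (a i) z - (i%:R - n%:R) *: a i \in V i.+1].
Proof.
have [alpha [beta [h1 hi]]] := weights_exist.
(* Since [a_n, x] = 0 the last weight vanishes, which makes every weight for i >= 2 equal to alpha
   (i - n). *)
have an0 : beta + (n - 2)%:R * alpha = 0.
  apply/eqP; rewrite -oppr_eq0; apply/eqP; apply: (@a_free n); first by lia.
  by have := hi n; rewrite br_an_left sub0r scaleNr; apply; lia.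
have wE i : (2 <= i)%N -> beta + (i - 2)%:R * alpha = alpha * (i%:R - n%:R).
  move=> i2; move/eqP: an0; rewrite addr_eq0 => /eqP ->.
  by rewrite !natrB; [ring|lia|lia].
have alpha0 : alpha != 0.
  apply/eqP => a0.
  (* Maximality of [V 1] would then make it the whole space, against [xV1]. *)
  have nil : nilpotent br fullv.
    apply: nilpotent_full; first by move: h1; rewrite a0 scale0r subr0.
    by move=> i i2; have := hi i i2; rewrite wE // a0 mul0r scale0r subr0.
  have idf : ideal br fullv by move=> u y _; rewrite !memvf.
  by move: xV1; rewrite -(V1_max idf nil (subvf _)) memvf.
exists (alpha^-1 *: x); split.
- by apply: contra xV1 => /(memvZ alpha); rewrite scalerA divff // scale1r.
- move=> y; have [t ht] := codim1 y; exists (t * alpha).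
  by rewrite scalerA mulfK.
- move/(memvZ alpha^-1): h1; rewrite scalerBr scalerA mulVf // scale1r.
  by rewrite linearZr_LR.
move=> i i2; move/(memvZ alpha^-1): (hi i i2).
by rewrite wE // scalerBr scalerA mulKf // linearZr_LR.
Qed.

(** * Eigenvectors of right multiplication by the normalized [x] *)

Section Normalized.
Hypothesis F0 : [pchar F] =i pred0.
Hypothesis a1x : br (a 1) x - a 1 \in V 2.
Hypothesis aix : forall i, (2 <= i)%N -> br (a i) x - (i%:R - n%:R) *: a i \in V i.+1.

(** On [V j] the operator [-, x] - mu is triangular with nonzero diagonal entries i - n - mu; the
    equation is solved by substitution from the leading term on. *)
Lemma shifted_solve mu j w : (2 <= j)%N ->
  (forall i, (j <= i <= n)%N -> i%:R - n%:R != mu) ->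
  w \in V j -> exists2 v, v \in V j & br v x - mu *: v = w.
Proof.
have [d] := ubnP (n.+1 - j); elim: d j w => // d IH j w hd j2 hmu hw.
have [hj|hj] := ltnP n j.
  move: hw; rewrite tail_big // memv0 => /eqP ->.
  by exists 0; rewrite ?mem0v // linear0l scaler0 subr0.
have [c hc] := tail_split a_big hw.
have nz : j%:R - n%:R - mu != 0 by rewrite subr_eq0 hmu ?leqnn.
pose b := c / (j%:R - n%:R - mu); set r := br (a j) x - (j%:R - n%:R) *: a j.
have [v hv ev] : exists2 v, v \in V j.+1 & br v x - mu *: v = w - c *: a j - b *: r.
  apply: IH; [lia|lia|by move=> i hi; apply: hmu; lia|].
  by rewrite memvB ?memvZ ?aix.
exists (b *: a j + v).
  by rewrite memvD ?memvZ ?mem_tail // (tailW a_big _ hv).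
have cE : c *: a j = (b * (j%:R - n%:R)) *: a j - (mu * b) *: a j.
  by rewrite -scalerBl; congr (_ *: _); rewrite [mu * b]mulrC -mulrBr divfK.
rewrite linearPl scalerDr opprD addrACA ev -[br (a j) x](subrK ((j%:R - n%:R) *: a j)) -/r.
rewrite scalerDr !scalerA -[_ + _ - _ *: a j]addrA -cE addrC.
by rewrite addrA !subrK.
Qed.

(** The error of a_1 is corrected inside [V 2], whose weights i - n differ from 1, and that of a_2
    inside [V 3], whose weights differ from 2 - n. *)
Lemma eigenvectors_exist : exists e1 e2,
  [/\ e1 - a 1 \in V 2, br e1 x = e1, e2 - a 2 \in V 3
    & br e2 x = (2%:R - n%:R) *: e2].
Proof.
have [||v hv ev] := shifted_solve (mu := 1) (w := - (br (a 1) x - a 1)) (leqnn 2).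
- by move=> i hi; rewrite subr_eq -(natrD _ 1 n) eqr_nat_pchar0 //; lia.
- by rewrite memvN.
have [|||w hw ew] := shifted_solve (mu := 2%:R - n%:R) (j := 3)
  (w := - (br (a 2) x - (2%:R - n%:R) *: a 2)) => //.
- by move=> i hi; rewrite subr_eq subrK eqr_nat_pchar0 //; lia.
- by rewrite memvN aix.
exists (a 1 + v), (a 2 + w); split; rewrite ?[_ + v]addrC ?[_ + w]addrC ?addrK //.
  by rewrite linearDl -[br v x](subrK (1 *: v)) /= ev opprB addrAC subrK scale1r addrC.
rewrite linearDl -[br w x](subrK ((2%:R - n%:R) *: w)) /= ew opprB addrAC subrK.
by rewrite scalerDr addrC.
Qed.

(** * The adapted basis and the isomorphism with R_{n+1,1}(0,0,1) *)

Section Adapted.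
Variables (e1 e2 : L).
Hypothesis e1a : e1 - a 1 \in V 2.
Hypothesis e1x : br e1 x = e1.
Hypothesis e2a : e2 - a 2 \in V 3.
Hypothesis e2x : br e2 x = (2%:R - n%:R) *: e2.

(* chain i is e_i, where e_{i+1} = [e_i, e_1] for i >= 2; chain 0 is a dummy. *)
Definition chain i : L := if i is j.+1 then
  if j is k.+1 then iter k (fun y => br y e1) e2 else e1 else 0.

Lemma chainS i : (2 <= i)%N -> chain i.+1 = br (chain i) e1.
Proof. by case: i => [|[|i]]. Qed.

Lemma chain_tail i : (1 <= i)%N -> chain i - a i \in V i.+1.
Proof.
case: i => [|[|i]] // _; elim: i => // i IH.
have cV : chain i.+2 \in V 2.
  rewrite -[chain _](subrK (a i.+2)) memvD ?mem_tail //.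
  by apply: (tailW a_big _ IH).
rewrite chainS // -[e1](subrK (a 1)) linearDr (tail22 cV e1a) add0r.
by rewrite -[chain _](subrK (a i.+2)) linearDl /= ai1 // addrK tail_br_a1.
Qed.

Lemma chain_tail2 i : (2 <= i)%N -> chain i \in V 2.
Proof.
move=> hi; rewrite -[chain _](subrK (a i)) memvD ?mem_tail //.
by apply: (tailW a_big _ (chain_tail _)); lia.
Qed.

Lemma chain_tail1 i : (1 <= i)%N -> chain i \in V 1.
Proof.
move=> hi; rewrite -[chain _](subrK (a i)) memvD ?mem_tail //.
by apply: (tailW a_big _ (chain_tail _)); lia.
Qed.

Lemma chain_n : chain n = a n.
Proof.
have := chain_tail (i := n); rewrite tail_big // memv0 subr_eq0 => h.
by apply/eqP/h; lia.
Qed.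

Lemma chain_x i : (2 <= i)%N -> br (chain i) x = (i%:R - n%:R) *: chain i.
Proof.
case: i => [|[|i]] // _; elim: i => // i IH.
rewrite chainS // (leibniz_derivation leib) e1x IH linearZl_LR /=.
by rewrite -[X in X + _]scale1r -scalerDl -[in RHS]natr1; congr (_ *: _); ring.
Qed.

(** The passage from the a_i to the e_i is unitriangular by [chain_tail], so the e_i span [V 1] as
    well. *)
Lemma chain_ind (P : L -> Prop) :
  P 0 -> (forall c u v, P u -> P v -> P (c *: u + v)) ->
  (forall i, (1 <= i <= n)%N -> P (chain i)) ->
  forall v, v \in V 1 -> P v.
Proof.
move=> P0 PL Pc.
suff H d k : (n.+1 - k < d)%N -> (1 <= k)%N -> forall v, v \in V k -> P v.
  by apply: (H n.+2 1%N); lia.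
elim: d k => // d IH k hd k1 v hv.
have [hk|hk] := ltnP n k.
  by move: hv; rewrite tail_big // memv0 => /eqP ->.
have [c hw] := tail_split a_big hv.
rewrite -[v](subrKC (c *: chain k)); apply: PL; first by apply: Pc; lia.
apply: (IH k.+1); [lia|by []|].
have -> : v - c *: chain k = v - c *: a k - c *: (chain k - a k).
  by rewrite scalerBr opprB addrA subrK.
by rewrite memvB ?memvZ ?chain_tail.
Qed.

(** Both [x, u] + lam u and [x, x] lie in [V n], whose left products vanish. The Leibniz identity
    for x, u, x thus reads lam [x, u] = - lam^2 u, and lam cancels. *)
Lemma left_eigen lam u : u \in V 1 -> lam != 0 -> br u x = lam *: u ->
  br x u = - (lam *: u).
Proof.
move=> hu lam0 uz; have hs := sym_tail x u; rewrite uz in hs.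
have sz : br (br x u + lam *: u) x = 0.
  by have [c ->] := tail_line a_big hs; rewrite linearZl_LR /= br_an_left scaler0.
have zz : br (br x x) u = 0.
  by have [c ->] := tail_line a_big (sq_tail x); rewrite linearZl_LR /= br_an_left scaler0.
have := leib x u x; rewrite zz subr0 uz linearZr_LR /=.
move: sz; rewrite linearDl linearZl_LR /= uz => /eqP; rewrite addr_eq0 => /eqP -> /eqP.
by rewrite -scalerN => /eqP /(scalerI lam0).
Qed.

Lemma x_chain1 : br x e1 = - e1.
Proof.
by rewrite (@left_eigen 1) ?scale1r ?oner_eq0 //; apply: (chain_tail1 (i := 1)).
Qed.

Lemma x_chain i : (2 <= i <= n)%N -> br x (chain i) = - ((i%:R - n%:R) *: chain i).
Proof.
(* The eigenvalue is zero exactly at i = n, where [br_an_right] replaces [left_eigen]. *)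
move=> /andP[i2 ni]; have [->|ne] := eqVneq i n.
  by rewrite subrr scale0r oppr0 chain_n br_an_right.
apply: left_eigen; rewrite ?chain_x ?chain_tail1 //; first by lia.
by rewrite subr_eq0 eqr_nat_pchar0.
Qed.

Lemma tail_alt v : v \in V 1 -> br v v = 0.
Proof.
move=> hv; have := tail_anti hv hv => /eqP.
rewrite -addr_eq0 -mulr2n -scaler_nat scaler_eq0.
by have /pcharf0P -> := F0; move=> /= /eqP.
Qed.

(** On [V 1] both [v, v] and [v, x] + [x, v] vanish, so the square of v + t x is t^2 [x, x]; were it
    always zero, the algebra would be Lie. *)
Lemma x_sq : exists2 c, c != 0 & br x x = c *: a n.
Proof.
have [c zz] := tail_line a_big (sq_tail x); exists c => //.
apply/eqP => c0; apply: nlie; apply: leibniz_sq0_lie => // u.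
have [t ht] := codim1 u; rewrite -[u](subrK (t *: x)).
move: (u - t *: x) ht => v hv; rewrite linearDl !linearDr /=.
have v0 : br v v = 0 by exact: tail_alt.
have vz : br v x + br x v = 0.
  move: v hv {v0}; apply: chain_ind => [|d u1 u2 h1 h2|i hi].
  - by rewrite linear0l linear0r addr0.
  - by rewrite linearPl linearPr addrACA -scalerDr h1 h2 scaler0 addr0.
  have [->|i1] := eqVneq i 1%N; first by rewrite /= e1x x_chain1 subrr.
  by rewrite chain_x ?x_chain ?subrr //; lia.
rewrite v0 add0r linearZr_LR !linearZl_LR /= addrA -scalerDr vz scaler0 add0r.
by rewrite linearZr_LR zz c0 scale0r !scaler0.
Qed.

Lemma tail1_iso : \dim {:L} = n.+1 -> alg_iso br (R1_bracket F n 0 0 1).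
Proof.
move=> dimL; have [c c0 zz] := x_sq.
(* Scaling e_2, ..., e_n by [c] preserves the other relations and turns [x, x] = c a_n into [x, x] =
   b_n. *)
pose b i := if i == n.+1 then x else if i == 1%N then e1 else c *: chain i.
have spanb (W : {vspace L}) :
    (forall i, (1 <= i <= n.+1)%N -> b i \in W) -> W = fullv.
  move=> hW; apply/eqP; rewrite eqEsubv subvf; apply/subvP => y _.
  have zW : x \in W by have := hW n.+1; rewrite /b eqxx; apply; lia.
  have [t ht] := codim1 y; rewrite -[y](subrK (t *: x)) memvD ?memvZ //.
  move: (y - t *: x) ht; apply: chain_ind => [|d u v hu hv|i hi].
  - exact: mem0v.
  - by rewrite memvD ?memvZ.
  have := hW i; rewrite /b (_ : i == n.+1 = false); last by lia.
  case: eqP => [->|_ h]; first by apply; lia.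
  have /(memvZ c^-1) : c *: chain i \in W by apply: h; lia.
  by rewrite scalerA mulVf // scale1r.
have b1 : b 1 = e1 by rewrite /b (_ : 1%N == n.+1 = false) //; lia.
have bz : b n.+1 = x by rewrite /b eqxx.
have bk k : (2 <= k <= n)%N -> b k = c *: chain k.
  move=> hk; rewrite /b (_ : k == n.+1 = false); last by lia.
  by rewrite (_ : k == 1%N = false) //; lia.
have bV1 k : (1 <= k <= n)%N -> b k \in V 1.
  move=> hk; have [->|k1] := eqVneq k 1%N; first by rewrite b1 (chain_tail1 (i := 1)).
  by rewrite bk ?memvZ ?chain_tail1 //; lia.
have bV2 k : (2 <= k <= n)%N -> b k \in V 2.
  by move=> hk; rewrite bk // memvZ ?chain_tail2 //; lia.
have bn : b n = c *: a n by rewrite bk ?chain_n //; lia.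
have r11 : br (b 1) (b 1) = 0 by rewrite tail_alt // bV1 //; lia.
have rk1 k : (2 <= k <= n.-1)%N -> br (b k) (b 1) = b k.+1.
  move=> hk; rewrite b1 (bk k); last by lia.
  rewrite (bk k.+1); last by lia.
  by rewrite chainS ?linearZl_LR //; lia.
have r1k k : (2 <= k <= n.-1)%N -> br (b 1) (b k) = - b k.+1.
  by move=> hk; rewrite tail_anti ?rk1 // bV1 //; lia.
have rnk k : br (b n) (b k) = 0 by rewrite bn linearZl_LR /= br_an_left scaler0.
have rkn k : br (b k) (b n) = 0 by rewrite bn linearZr_LR /= br_an_right scaler0.
have rkl k l : (2 <= k <= n)%N -> (2 <= l <= n)%N -> br (b k) (b l) = 0.
  by move=> hk hl; rewrite (tail22 (bV2 _ _) (bV2 _ _)).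
have rkz k : (2 <= k <= n)%N -> br (b k) (b n.+1) = (k%:R - n%:R) *: b k.
  move=> hk; rewrite bz bk // linearZl_LR /= chain_x; last by lia.
  by rewrite !scalerA mulrC.
have rzk k : (2 <= k <= n)%N -> br (b n.+1) (b k) = - ((k%:R - n%:R) *: b k).
  move=> hk; rewrite bz bk // linearZr_LR /= x_chain //.
  by rewrite scalerN !scalerA mulrC.
have r1z : br (b 1) (b n.+1) = b 1 by rewrite b1 bz.
have rz1 : br (b n.+1) (b 1) = - b 1 by rewrite b1 bz x_chain1.
have rzz : br (b n.+1) (b n.+1) = b n by rewrite bz bn.
by apply: (R1_recognition hn dimL spanb) => // k *;
  rewrite ?rkz ?rzk ?rkl //; lia.
Qed.

End Adapted.
End Normalized.
End Chain.

(** * From the abstract nilradical to the vectors a_i *)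

Lemma tail_free (F : fieldType) (L : vectType F) n (a : nat -> L) :
  (forall k c, (1 <= k <= n)%N -> c *: a k \in tail n a k.+1 -> c = 0) ->
  free [seq a i | i <- iota 1 n].
Proof.
move=> a_free.
suff H d k : (k + d)%N = n.+1 -> (1 <= k)%N -> free [seq a i | i <- iota k d] by exact: H.
elim: d k => [|d IH] k hd k1; first exact: nil_free.
rewrite /= free_cons IH ?andbT //; last by lia.
have -> : <<[seq a i | i <- iota k.+1 d]>>%VS = tail n a k.+1.
  by rewrite /tail (_ : n.+1 - k.+1 = d)%N //; lia.
apply/negP => h; have := a_free k 1; rewrite scale1r => /(_ _ h) e.
by have /eqP := e ltac:(lia); rewrite oner_eq0.
Qed.

Lemma non_lie_leibniz_n1_iso (F : fieldType) (n : nat) (L : vectType F)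
    (br : {bilinear L -> L -> L}) (N : {vspace L}) :
  [pchar F] =i pred0 -> (4 <= n)%N -> \dim {:L} = n.+1 ->
  leibniz br -> ~ lie br -> is_nilradical br N ->
  alg_iso (subv_bracket br N) (n1_bracket F n) ->
  alg_iso br (R1_bracket F n 0 0 1).
Proof.
move=> F0 hn dimL leib nlie [N_ideal _ N_max] /alg_iso_sym[g [g_bij gM]].
have g_inj := bij_inj g_bij.
pose h := (vsval : subvs_of N -> L) \o g.
have hP c u v : h (c *: u + v) = c *: h u + h v by rewrite /h /= !linearP.
have h0 : h 0 = 0 by rewrite /h /= !linear0.
have hZ c u : h (c *: u) = c *: h u by rewrite -[c *: u]addr0 hP h0 addr0.
have hN u : h (- u) = - h u by rewrite -scaleN1r hZ scaleN1r.
have h_inj : injective h by move=> u v /subvs_inj /g_inj.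
have hV u : h u \in N by exact: subvsP.
have hM u v : h (n1_bracket F n u v) = br (h u) (h v).
  by rewrite /h /= gM /subv_bracket vsprojK //; case: (N_ideal _ (h v) (hV u)).
(* [evec F n i] is zero for i > n, so the relations below hold without an upper bound on i. *)
pose a i := h (evec F n i).
have a_big i : (n < i)%N -> a i = 0 by move=> ni; rewrite /a evec_eq0 ?h0 //; lia.
have aM i j : (1 <= i <= n)%N -> (1 <= j <= n)%N -> br (a i) (a j) = h (n1_table F n i j).
  by move=> hi hj; rewrite -hM /n1_bracket table_bracket_evec.
have a11 : br (a 1) (a 1) = 0.
  by rewrite aM; [rewrite /n1_table /= h0|lia|lia].
have ai1 i : (2 <= i)%N -> br (a i) (a 1) = a i.+1.
  move=> hi; have [ni|ni] := ltnP n i; first by rewrite (a_big i) // (a_big i.+1) ?linear0l //; lia.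
  rewrite aM; [|lia|lia]; rewrite /n1_table eqxx hi /= (_ : i == 1%N = false); last by lia.
  by case: ifP => // nin; rewrite h0 a_big //; lia.
have a1i i : (2 <= i)%N -> br (a 1) (a i) = - a i.+1.
  move=> hi; have [ni|ni] := ltnP n i.
    by rewrite (a_big i) // (a_big i.+1) ?linear0r ?oppr0 //; lia.
  rewrite aM; [|lia|lia]; rewrite /n1_table eqxx hi /= andbF.
  case: ifP => nin; first by rewrite hN.
  by rewrite h0 a_big ?oppr0 //; lia.
have aij i j : (2 <= i)%N -> (2 <= j)%N -> br (a i) (a j) = 0.
  move=> hi hj; have [ni|ni] := ltnP n i; first by rewrite a_big ?linear0l.
  have [nj|nj] := ltnP n j; first by rewrite (a_big j) ?linear0r.
  rewrite aM; [|lia|lia]; rewrite /n1_table.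
  by rewrite (_ : i == 1%N = false) 1?(_ : j == 1%N = false) ?h0 //; lia.
have a_free k c : (1 <= k <= n)%N -> c *: a k \in tail n a k.+1 -> c = 0.
  case: k => // k hk hc; pose o := Ordinal (hk : (k < n)%N).
  (* Vectors of the smaller tail are images of rows with zero entry at [o], the zero-based position
     of a_{k+1}. *)
  have : exists2 u, h u = c *: a k.+1 & u 0 o = 0.
    apply: (tail_ind a_big (P := fun v => exists2 u, h u = v & u 0 o = 0) _ _ _ hc).
    - by exists 0; rewrite ?h0 ?mxE.
    - move=> d _ _ [u <- uo] [v <- vo]; exists (d *: u + v); first exact: hP.
      by rewrite !mxE uo vo mulr0 addr0.
    move=> i ki _; exists (evec F n i) => //; rewrite mxE /=.
    by case: eqP => // ?; exfalso; lia.
  move=> [u hu uo]; have /h_inj e : h u = h (c *: evec F n k.+1) by rewrite hu hZ.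
  by move: uo; rewrite e !mxE eqxx mulr1.
have NE : tail n a 1 = N.
  apply/eqP; rewrite eqEsubv; apply/andP; split; apply/subvP => v hv.
    apply: (tail_ind a_big (P := fun v => v \in N) _ _ _ hv) => [|c u w|i _ _].
    - exact: mem0v.
    - by move=> hu hw; rewrite memvD ?memvZ.
    exact: hV.
  have [ginv _ gK] := g_bij.
  have -> : v = h (ginv (vsproj N v)) by rewrite /h /= gK vsprojK.
  rewrite [ginv _]row_sum_evec; elim/big_ind: _ => [|u w hu hw|i _].
  - by rewrite h0 mem0v.
  - by rewrite -[u]scale1r hP scale1r memvD.
  by rewrite hZ memvZ // mem_tail.
have a_lin : free [seq a i | i <- iota 1 n] by exact: tail_free a_free.
have dimN : \dim (tail n a 1) = n.
  by rewrite /tail subn1 (eqP a_lin) size_map size_iota.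
rewrite -NE in N_ideal N_max.
have [x _ xN] : exists2 x, x \in fullv & x \notin tail n a 1.
  by apply/subvPn/negP => /dimvS; rewrite dimL dimN ltnn.
have codim1 y : exists t, y - t *: x \in tail n a 1.
  have full : (<[x]> + tail n a 1 == fullv)%VS.
    have : free (x :: [seq a i | i <- iota 1 n]).
      by rewrite free_cons a_lin andbT; move: xN; rewrite /tail subn1.
    move=> /eqP dimx; rewrite eqEdim subvf dimL /tail subn1 -span_cons dimx.
    by rewrite /= size_map size_iota.
  have := memvf y; rewrite -(eqP full) => /memv_addP[_ /vlineP[t ->] [w hw ->]].
  by exists t; rewrite addrC addKr.
have [z [zN codimz a1z aiz]] :=
  normalized_exist hn a_big a_free a11 ai1 a1i aij leib nlie N_ideal xN codim1 N_max.
have [e1 [e2 [e1a e1z e2a e2z]]] := eigenvectors_exist hn a_big zN F0 a1z aiz.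
exact: (tail1_iso hn a_big a_free a11 ai1 a1i aij leib nlie N_ideal zN codimz F0 a1z
  e1a e1z e2a e2z dimL).
Qed.

(* C is R[i], for an arbitrary model R of the real numbers. *)
Theorem theorem3p1 (R : realType) (n : nat) (hn : (4 <= n)%N) :
  (forall (L : vectType R[i]) (br : {bilinear L -> L -> L}) (N : {vspace L}),
      \dim {:L} = n.+1 ->
      leibniz br -> ~ lie br -> solvable br ->
      is_nilradical br N ->
      alg_iso (subv_bracket br N) (n1_bracket R[i] n) ->
      [\/ alg_iso br (R1_bracket R[i] n 0 0 1),
          alg_iso br (R1_bracket R[i] n 0 1 0),
          alg_iso br (R1_bracket R[i] n 1 1 0)
        | alg_iso br (R1_bracket R[i] n 1 0 0)])
  /\ (~ alg_iso (R1_bracket R[i] n 0 0 1) (R1_bracket R[i] n 0 1 0) /\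
      ~ alg_iso (R1_bracket R[i] n 0 0 1) (R1_bracket R[i] n 1 1 0) /\
      ~ alg_iso (R1_bracket R[i] n 0 0 1) (R1_bracket R[i] n 1 0 0) /\
      ~ alg_iso (R1_bracket R[i] n 0 1 0) (R1_bracket R[i] n 1 1 0) /\
      ~ alg_iso (R1_bracket R[i] n 0 1 0) (R1_bracket R[i] n 1 0 0) /\
      ~ alg_iso (R1_bracket R[i] n 1 1 0) (R1_bracket R[i] n 1 0 0)).
Proof.
have C0 : [pchar R[i]] =i pred0 by exact: Num.Theory.pchar_num.
split=> [L br N dimL leib nlie _ nilN isoN|].
  by apply: Or41; exact: non_lie_leibniz_n1_iso isoN.
(* The four pairs (gamma_1, gamma_2) realise the four distinct vanishing patterns. *)
by do !split; move=> /(R1_iso_gamma C0 hn)[]; rewrite ?eqxx ?oner_eq0.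
Qed.
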